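(* Let $G$ be a finite group, $N\triangleleft G$ a normal subgroup, $F:G\to\mathbb{C}$ a function, $\rho$ an irreducible unitary representation of $G$, $\chi:=\mathrm{Tr}\,\rho$, and $q$ an even positive integer. Then one has $$\|\widehat F(\rho)\|_{S^q}^q \le \frac{|G|}{\sum_{n\in N}|\chi(n)|^2}\sum_{\substack{g_1,\ldots,g_q\in G \\ g_1\cdots g_q\in N}}F(g_1)\,\overline F(g_2^{-1})\cdots F(g_{q-1})\,\overline F(g_q^{-1})\,\chi(g_1\cdots g_q).$$
   Context: Representations are finite-dimensional, complex and unitary: $\rho:G\to U(V)$. The Fourier coefficient of $F$ at $\rho$ is the linear map $\widehat F(\rho):=\sum_{g\in G}F(g)\rho(g):V\to V$. For a linear map $A$ between finite-dimensional Hilbert spaces, $\|A\|_{S^q}$ is the $\ell^q$ norm of the singular values of $A$. $\overline F(g)$ is the complex conjugate of $F(g)$. In the product, odd-indexed $g_i$ contribute $F(g_i)$ and even-indexed $g_i$ contribute $\overline F(g_i^{-1})$. *)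

(* Defs.v *)
From mathcomp Require Import all_boot all_order all_algebra all_fingroup.
From mathcomp Require Import all_solvable all_field all_character.
From mathcomp Require Import spectral complex.
From mathcomp Require Import reals.

Set Implicit Arguments.
Unset Strict Implicit.
Unset Printing Implicit Defensive.

Import Order.TTheory GRing.Theory Num.Theory.
Local Open Scope ring_scope.
Local Open Scope sesquilinear_scope.

Section Schatten.
Variable C : numClosedFieldType.

(* Square roots of the eigenvalues, with multiplicity, of the positive
   semidefinite Hermitian matrix A^* A. When A is m x n with m < n, this list
   has at least n - m zero entries beyond the usual min(m, n) singular values;
   they do not affect the l^q norm for q > 0. *)
Definition singular_values m n (A : 'M[C]_(m, n)) : 'rV[C]_n :=
  map_mx sqrtC (spectral_diag (A^t* *m A)).

(* Meaningful for q > 0. *)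
Definition schatten_norm (q : nat) m n (A : 'M[C]_(m, n)) : C :=
  q.-root (\sum_(i < n) singular_values A 0 i ^+ q).

End Schatten.

Section Representations.
Variables (C : numClosedFieldType) (gT : finGroupType) (G : {group gT}).
Variables (d : nat) (rho : mx_representation C G d).

Definition unitary_repr : Prop := {in G, forall g, rho g \is unitarymx}.

Definition repr_char (g : gT) : C := \tr (rho g).

Definition fourier_coef (F : gT -> C) : 'M[C]_d := \sum_(g in G) F g *: rho g.

End Representations.

(* F(g_1) conj(F(g_2^-1)) F(g_3) conj(F(g_4^-1)) ...; since 'I_q counts from 0,
   g_1, g_3, ... are the values of g at the even ordinals. *)
Definition alternating_prod (C : numClosedFieldType) (gT : finGroupType)
    (F : gT -> C) (q : nat) (g : {ffun 'I_q -> gT}) : C :=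
  \prod_(i < q) (if odd i then (F ((g i)^-1)%g)^* else F (g i)).

(* Main.v *)
(* Let k be the group-algebra product F F^* F F^* ... with q/2 factors, so that
   F F^* ... F F^* (q factors) is k k^*. For a function phi on G put
   Q_phi(a, b) = sum_(u, v) a(u) conj(b(v)) phi(u v^-1). The left-hand side is
   then Q_chi(k, k), and the sum on the right is Q_phi(k, k), where phi = chi on
   N and 0 elsewhere. The form Q_phi is positive semidefinite: it splits as a sum
   over the cosets of N. Let e = (d / |G|) conj(chi), the central idempotent of
   rho. As phi is a class function, Schur's lemma gives
   Q_phi(e a, b) = (S / |G|) Q_chi(a, b) with S = sum_(n in N) |chi(n)|^2, and
   expanding Q_phi((1 - e) k, (1 - e) k) >= 0 yields
   Q_phi(k, k) >= (S / |G|) Q_chi(k, k). *)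
Require Import Defs.
From mathcomp Require Import all_boot all_order all_algebra all_fingroup.
From mathcomp Require Import all_solvable all_field all_character.
From mathcomp Require Import spectral complex.
From mathcomp Require Import reals ring.

Set Implicit Arguments.
Unset Strict Implicit.
Unset Printing Implicit Defensive.

Import Order.TTheory GRing.Theory Num.Theory.
Local Open Scope ring_scope.

(** * Traces of powers and Schatten norms of matrices *)

Section Matrices.
Local Open Scope sesquilinear_scope.
Variable C : numClosedFieldType.

Lemma mxtrace_adj n (A : 'M[C]_n) : \tr (A^t*) = (\tr A)^*.
Proof. by rewrite rmorph_sum; apply: eq_bigr => i _; rewrite !mxE. Qed.

Lemma mxtrace_mul_adj_ge0 m n (A : 'M[C]_(m, n)) : 0 <= \tr (A *m A^t*).
Proof.
apply: sumr_ge0 => i _; rewrite mxE; apply: sumr_ge0 => j _.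
by rewrite !mxE mul_conjC_ge0.
Qed.

(** A power of [A *m B] is [A], a lower power of [B *m A], then [B]; cyclicity of the trace moves
    the outer [A] across. At exponent 0 the traces would be [m] and [n], hence [0 < p]. *)
Lemma mxtrace_expr_mulC m n (A : 'M[C]_(m, n)) (B : 'M_(n, m)) p :
  (0 < p)%N -> \tr ((A *m B) ^+ p) = \tr ((B *m A) ^+ p).
Proof.
have expE q : (A *m B) ^+ q.+1 = A *m (B *m A) ^+ q *m B.
  elim: q => [|q IHq]; first by rewrite expr1 expr0 mulmx1.
  by rewrite exprS IHq [in RHS]exprS -![_ * _]/(_ *m _) !mulmxA.
by case: p => // p _; rewrite expE mxtrace_mulC mulmxA exprS.
Qed.

(** By the spectral theorem the right-hand side is the sum of the [p]-th powers of the eigenvalues,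
    which are the squares of the singular values. *)
Lemma schatten_normX m n (A : 'M[C]_(m, n)) p : (0 < p)%N ->
  schatten_norm p.*2 A ^+ p.*2 = \tr ((A^t* *m A) ^+ p).
Proof.
move=> p_gt0; rewrite /schatten_norm rootCK ?double_gt0 //.
set B := A^t* *m A; have adjB : B^t* = B.
  by rewrite /B trmx_mul map_mxM trmxCK.
have /orthomx_spectralP : B \is normalmx by apply/normalmxP; rewrite adjB.
set P := spectralmx B; set D := spectral_diag B => defB.
have P_unit : P \in unitmx by apply: spectral_unit.
have expB q : B ^+ q = invmx P *m diag_mx (map_mx (fun x => x ^+ q) D) *m P.
  elim: q => [|q IHq].
    rewrite expr0 (_ : diag_mx _ = 1%:M) ?mulmx1 ?mulVmx //.
    by rewrite -diag_const_mx; congr diag_mx; apply/rowP => i; rewrite !mxE.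
  rewrite exprS IHq {1}defB -![_ * _]/(_ *m _) !mulmxA mulmxK //.
  rewrite -[X in X *m P = _]mulmxA mulmx_diag; congr (_ *m diag_mx _ *m _).
  by apply/rowP => i; rewrite !mxE exprS.
rewrite expB mxtrace_mulC mulmxA mulmxV // mul1mx mxtrace_diag.
by apply: eq_bigr => i _; rewrite !mxE -mul2n exprM sqrtCK.
Qed.

End Matrices.

(** * Weighted sums over words in a group *)

Section Words.
Variables (C : numClosedFieldType) (gT : finGroupType) (G : {group gT}).
Implicit Types (w : nat -> gT -> C) (psi : gT -> C).

(** Sum over words of length [n] in [G], with [w i] weighting letter [i] and [psi] evaluated at the
    product of the word. The recursion removes the last letter and absorbs it into [psi], so that
    words can be cut by induction. *)
Fixpoint word_sum n w psi : C :=
  if n is m.+1 then \sum_(g in G) w m g * word_sum m w (fun x => psi (x * g)%g)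
  else psi 1%g.

Lemma eq_word_sum n w w' psi psi' :
    (forall i x, (i < n)%N -> w i x = w' i x) -> {in G, psi =1 psi'} ->
  word_sum n w psi = word_sum n w' psi'.
Proof.
elim: n psi psi' => [|n IHn] psi psi' eq_w eq_psi /=; first exact: eq_psi.
apply: eq_bigr => g Gg; rewrite eq_w //; congr (_ * _).
by apply: IHn => [i x lt_i_n | x Gx]; rewrite ?eq_w ?eq_psi ?groupM 1?ltnW.
Qed.

Lemma word_sumE n w psi :
  \sum_(g : {ffun 'I_n -> gT} | [forall i, g i \in G])
    (\prod_(i < n) w i (g i)) * psi (\prod_(i < n) g i)%g = word_sum n w psi.
Proof.
elim: n psi => [|n IHn] psi /=.
  rewrite (big_pred1 [ffun _ => 1%g]) => [|g]; first by rewrite !big_ord0 mul1r.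
  have -> : g = [ffun _ => 1%g] by apply/ffunP => -[].
  by rewrite /= eqxx; apply/forallP => -[].
(* The last letter sits at [ord_max], matching the recursion of [word_sum]. *)
pose glue (p : gT * {ffun 'I_n -> gT}) : {ffun 'I_n.+1 -> gT} :=
  [ffun i => oapp p.2 p.1 (unlift ord_max i)].
pose split (f : {ffun 'I_n.+1 -> gT}) := (f ord_max, [ffun i => f (lift ord_max i)]).
have glueK : cancel glue split.
  case=> x f; rewrite /split /glue ffunE unlift_none; congr (_, _).
  by apply/ffunP => i; rewrite !ffunE liftK.
have splitK : cancel split glue.
  move=> f; apply/ffunP => i; rewrite ffunE /=.
  by case: unliftP => [j|] -> //=; rewrite ffunE.
have widenE i : widen_ord (leqnSn n) i = lift ord_max i.
  exact/val_inj/esym/lift_max.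
rewrite (reindex glue); last by exists split => ? _; [exact: glueK | exact: splitK].
under [RHS]eq_bigr => x _ do rewrite -IHn big_distrr /=.
rewrite pair_big_dep /=; apply: eq_big => [[x f]|[x f] _] /=.
  apply/forallP/andP => [Gf|[Gx /forallP Gf] i].
    split; first by have := Gf ord_max; rewrite ffunE unlift_none.
    by apply/forallP => i; have := Gf (lift ord_max i); rewrite ffunE liftK.
  by rewrite ffunE; case: (unlift _ _) => [j|] //=; apply: Gf.
rewrite !big_ord_recr /= !ffunE unlift_none /= [_ * w n x]mulrC -mulrA.
congr (_ * (_ * psi (_ * _)%g)).
  by apply: eq_bigr => i _; rewrite widenE ffunE liftK.
by apply: eq_bigr => i _; rewrite widenE ffunE liftK.
Qed.

Lemma word_sum_lin (I : Type) (r : seq I) (P : pred I) (c : I -> C)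
    (psi : I -> gT -> C) n w :
  word_sum n w (fun x => \sum_(i <- r | P i) c i * psi i x) =
  \sum_(i <- r | P i) c i * word_sum n w (psi i).
Proof.
elim: n psi => //= n IHn psi.
under eq_bigr => g _ do rewrite IHn big_distrr /=.
rewrite exchange_big; apply: eq_bigr => i _; rewrite big_distrr /=.
by apply: eq_bigr => g _; rewrite mulrCA.
Qed.

(** The coefficient at [u] of the group-algebra product of [w 0], ..., [w n.-1], in that order. *)
Definition word_coef n w u := word_sum n w (fun x => (x == u)%:R).

Lemma word_sum_coef n w psi :
  word_sum n w psi = \sum_(u in G) word_coef n w u * psi u.
Proof.
under eq_bigr => u _ do rewrite mulrC.
rewrite -word_sum_lin; apply: eq_word_sum => // x Gx.
rewrite (bigD1 x) //= eqxx mulr1 big1 ?addr0 // => u /andP[_ /negPf neq_ux].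
by rewrite eq_sym neq_ux mulr0.
Qed.

Lemma word_sumD m n w psi :
  word_sum (m + n) w psi =
  word_sum m w (fun u => word_sum n (fun i => w (m + i)%N)
                                  (fun v => psi (u * v)%g)).
Proof.
elim: n psi => [|n IHn] psi.
  by rewrite addn0; apply: eq_word_sum => // x _ /=; rewrite mulg1.
rewrite addnS /= word_sum_lin; apply: eq_bigr => g _; rewrite IHn.
congr (_ * _); apply: eq_word_sum => // u _; apply: eq_word_sum => // v _.
by rewrite mulgA.
Qed.

Lemma word_sumSl n w psi :
  word_sum n.+1 w psi =
  \sum_(g in G) w 0 g * word_sum n (fun i => w i.+1) (fun x => psi (g * x)%g).
Proof.
rewrite -add1n word_sumD /=; apply: eq_bigr => g _; congr (_ * _).
by apply: eq_word_sum => // x _; rewrite mul1g.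
Qed.

(** Inverting a product reverses its letters, whence the index [n - i.+1]. The last letter on the
    left becomes the first on the right, which [word_sumSl] removes. *)
Lemma word_sum_conj n w psi :
  (word_sum n w psi)^* =
  word_sum n (fun i x => (w (n - i.+1)%N x^-1%g)^*) (fun x => (psi x^-1%g)^*).
Proof.
elim: n psi => [|n IHn] psi; first by rewrite /= invg1.
rewrite [RHS]word_sumSl /= rmorph_sum (reindex_inj invg_inj) /=.
apply: eq_big => [g|g _]; first by rewrite groupV.
rewrite rmorphM /= subSS subn0 IHn; congr (_ * _).
by apply: eq_word_sum => // x _; rewrite invMg.
Qed.

(* The second half of a palindromic word is the adjoint of the first. *)
Lemma word_sum_palindrome n w psi :
    (forall i x, (i < n)%N -> w (n + i)%N x = (w (n - i.+1)%N x^-1%g)^*) ->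
  word_sum (n + n) w psi =
  \sum_(u in G) \sum_(v in G)
    word_coef n w u * (word_coef n w v)^* * psi (u * v^-1)%g.
Proof.
move=> w_palindrome; rewrite word_sumD word_sum_coef; apply: eq_bigr => u _.
under eq_bigr => v _ do rewrite -mulrA.
rewrite -big_distrr; congr (_ * _) => /=.
(* Conjugating twice lets [word_sum_conj] turn the suffix letters back into those of the first
   half. *)
transitivity ((word_sum n w (fun v => (psi (u * v^-1)%g)^*))^*).
  rewrite word_sum_conj; apply: eq_word_sum => // x _.
  by rewrite invgK conjCK.
rewrite word_sum_coef rmorph_sum; apply: eq_bigr => v _.
by rewrite rmorphM /= conjCK.
Qed.

End Words.

(** * Hermitian forms attached to restricted characters *)

Section CharacterForms.
Local Open Scope sesquilinear_scope.
Variables (C : numClosedFieldType) (gT : finGroupType) (G : {group gT}).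
Variables (d : nat) (rho : mx_representation C G d).
Implicit Types (phi a b : gT -> C) (N : {group gT}).
Local Notation chi := (repr_char rho).

Definition herm_form phi a b : C :=
  \sum_(u in G) \sum_(v in G) a u * (b v)^* * phi (u * v^-1)%g.

Lemma herm_formBl phi a a' b :
  herm_form phi (fun x => a x - a' x) b = herm_form phi a b - herm_form phi a' b.
Proof.
rewrite /herm_form -sumrB; apply: eq_bigr => u _; rewrite -sumrB.
by apply: eq_bigr => v _; rewrite !mulrBl.
Qed.

Lemma herm_formBr phi a b b' :
  herm_form phi a (fun x => b x - b' x) = herm_form phi a b - herm_form phi a b'.
Proof.
rewrite /herm_form -sumrB; apply: eq_bigr => u _; rewrite -sumrB.
by apply: eq_bigr => v _; rewrite rmorphB mulrBr mulrBl.
Qed.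

Lemma herm_form_conj phi a b :
    {in G, forall x, phi x^-1%g = (phi x)^*} ->
  (herm_form phi a b)^* = herm_form phi b a.
Proof.
move=> phiV; rewrite /herm_form rmorph_sum.
under eq_bigr => u _ do rewrite rmorph_sum /=.
rewrite exchange_big; apply: eq_bigr => u Gu; apply: eq_bigr => v Gv /=.
by rewrite !rmorphM /= conjCK mulrC -phiV ?groupM ?groupV // invMg invgK mulrC
           [b u * _]mulrC.
Qed.

(** The function phi of the overview. Taking [N] to be [G] gives chi on [G], so both forms to be
    compared are instances. *)
Definition res_char N (x : gT) : C := if x \in N then chi x else 0.

Hypothesis rho_unitary : unitary_repr rho.

Lemma repr_mxV_adj x : x \in G -> rho x^-1%g = (rho x)^t*.
Proof. by move=> Gx; rewrite repr_mxV // invmx_unitary ?rho_unitary. Qed.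

Lemma repr_charV x : x \in G -> chi x^-1%g = (chi x)^*.
Proof. by move=> Gx; rewrite /repr_char repr_mxV_adj ?mxtrace_adj. Qed.

Lemma res_charV N : N \subset G ->
  {in G, forall x, res_char N x^-1%g = (res_char N x)^*}.
Proof.
move=> sNG x Gx; rewrite /res_char groupV.
by case: ifP; rewrite ?rmorph0 ?repr_charV.
Qed.

(* Up to the factor #|N|, the form is the sum over t in G of the squared
   Hilbert-Schmidt norms of the Fourier coefficients of a restricted to N t. *)
Lemma res_char_form_ge0 N a : N \subset G -> 0 <= herm_form (res_char N) a a.
Proof.
move=> sNG; rewrite -(pmulr_rge0 _ (_ : 0 < #|N|%:R)) ?ltr0n ?cardG_gt0 //.
pose A t := \sum_(u in G | (u * t^-1)%g \in N) a u *: rho u.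
suffices ->: #|N|%:R * herm_form (res_char N) a a =
             \sum_(t in G) \tr (A t *m (A t)^t*).
  by apply: sumr_ge0 => t _; apply: mxtrace_mul_adj_ge0.
transitivity (\sum_(t in G) \sum_(u in G) \sum_(v in G)
    (if ((u * t^-1)%g \in N) && ((v * t^-1)%g \in N) then
       a u * (a v)^* * chi (u * v^-1)%g else 0)); last first.
  apply: eq_bigr => t Gt; rewrite /A !linear_sum /= mulmx_suml linear_sum /=.
  rewrite big_mkcondr; apply: eq_bigr => u Gu; case: ifP => Nut; last first.
    by rewrite big1.
  rewrite map_mx_sum mulmx_sumr linear_sum /= big_mkcondr; apply: eq_bigr => v Gv /=.
  case: ifP => // Nvt; rewrite linearZ /= map_mxZ -scalemxAl -scalemxAr.
  by rewrite !linearZ /= -repr_mxV_adj // -repr_mxM ?groupV // mulrA.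
rewrite exchange_big big_distrr; apply: eq_bigr => u Gu /=.
rewrite exchange_big big_distrr; apply: eq_bigr => v Gv /=.
rewrite -big_mkcondr /= sumr_const /res_char.
(* For fixed [u] and [v], the contributing [t] have both [u] and [v] in [N t]: there are none if
   [u * v^-1] lies outside [N], and otherwise they fill the coset [N u], of size [#|N|]. *)
have [Nuv|notNuv] := ifP; last first.
  rewrite mulr0 mulr0 eq_card0 // => t; rewrite !inE.
  apply/negP => /and3P[_ Nut Nvt]; case/negP: notNuv.
  have -> : (u * v^-1 = (u * t^-1) * (v * t^-1)^-1)%g.
    by rewrite invMg invgK mulgA mulgKV.
  by rewrite groupM ?groupV.
rewrite mulr_natl; congr (_ *+ _); rewrite -(card_rcoset N u).
have Gcoset: (N :* u \subset G)%g by rewrite mul_subG ?sub1set.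
apply: eq_card => t; rewrite [RHS]unfold_in /=.
have -> : (v * t^-1 = (u * v^-1)^-1 * (u * t^-1))%g.
  by rewrite invMg invgK -mulgA mulKg.
rewrite [X in [&& _, _ & X]]groupMl ?groupV // andbb rcoset_sym mem_rcoset.
case Nut: (_ \in N); rewrite ?andbF // andbT.
by apply/esym/(subsetP Gcoset); rewrite rcoset_sym mem_rcoset.
Qed.


(** * Schur's lemma and comparison of the two forms *)

Hypothesis rho_irr : mx_irreducible rho.

Lemma mx_irr_degree_gt0 : (0 < d)%N.
Proof.
have [_ nz1 _] := rho_irr; rewrite lt0n; apply: contraNneq nz1 => d0.
by apply/eqP/matrixP => -[i lt_id]; exfalso; rewrite d0 in lt_id.
Qed.

(** Over a closed field [f] has an eigenvalue [a]. The singular matrix [f - a%:M] still commutes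
    with [rho], so it vanishes by Schur's lemma; the trace determines [a]. *)
Lemma centgmx_scalar (f : 'M_d) : centgmx rho f -> f = (\tr f / d%:R)%:M.
Proof.
move=> /centgmxP cent_f; have [a] := eigenvalue_closed f mx_irr_degree_gt0.
rewrite /eigenvalue /eigenspace kermx_eq0 row_free_unit => nunit.
have: f - a%:M == 0.
  apply: contraNT nunit; apply: (mx_Schur rho_irr); apply/centgmxP => x Gx.
  by rewrite mulmxBl mulmxBr cent_f // scalar_mxC.
rewrite subr_eq0 => /eqP ->; rewrite mxtrace_scalar -(mulr_natr a) mulfK //.
by rewrite pnatr_eq0 -lt0n mx_irr_degree_gt0.
Qed.

Lemma repr_char_conjg x y : x \in G -> y \in G -> chi (x ^ y) = chi x.
Proof.
move=> Gx Gy; rewrite /repr_char conjgE !repr_mxM ?groupM ?groupV //.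
by rewrite mxtrace_mulC -mulmxA -repr_mxM ?groupV // mulgV repr_mx1 mulmx1.
Qed.

Lemma res_char_conjg N x y :
  (N <| G)%g -> x \in G -> y \in G -> res_char N (x ^ y) = res_char N x.
Proof.
move=> /andP[_ nNG] Gx Gy; rewrite /res_char memJ_norm ?(subsetP nNG) //.
by rewrite repr_char_conjg.
Qed.

(** The operator [f] below commutes with [rho] because [res_char N] is a class function, so it is
    scalar; the left-hand side is the trace of [rho x *m f]. *)
Lemma res_char_convolution N x : (N <| G)%g -> x \in G ->
  \sum_(g in G) chi g^-1%g * res_char N (g * x)%g =
  (\sum_(n in N) `|chi n| ^+ 2) / d%:R * chi x.
Proof.
move=> nsNG Gx; have sNG := normal_sub nsNG.
pose f := \sum_(y in G) res_char N y *: rho y^-1%g.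
have fE : f = ((\sum_(n in N) `|chi n| ^+ 2) / d%:R)%:M.
  rewrite [LHS]centgmx_scalar; last first.
    apply/centgmxP => h Gh; rewrite mulmx_suml mulmx_sumr.
    rewrite (reindex_inj (conjg_inj h^-1%g)) /=.
    apply: eq_big => [y|y]; first by rewrite memJ_norm ?(subsetP (normG G)) ?groupV.
    rewrite memJ_norm ?(subsetP (normG G)) ?groupV // => Gy.
    rewrite res_char_conjg ?groupV // -scalemxAl -scalemxAr.
    rewrite -!repr_mxM ?groupV ?groupJ ?groupV //.
    by rewrite -conjVg conjgE invgK -mulgA mulgKV.
  congr (_ / _)%:M; rewrite linear_sum /= big_mkcond [RHS]big_mkcond.
  apply: eq_bigr => y _; rewrite linearZ /= /res_char.
  case: (boolP (y \in N)) => [Ny|_]; last by rewrite mul0r if_same.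
  by rewrite (subsetP sNG) // -/(chi _) repr_charV ?(subsetP sNG) // normCK.
transitivity (\tr (rho x *m f)); last first.
  by rewrite fE mul_mx_scalar mxtraceZ.
rewrite mulmx_sumr linear_sum (reindex_inj (mulIg x^-1%g)) /=.
apply: eq_big => [y|y]; first by rewrite groupMr ?groupV.
rewrite groupMr ?groupV // => Gy; rewrite mulgKV invMg invgK mulrC.
by rewrite -scalemxAr linearZ /= -repr_mxM ?groupV.
Qed.

(* Schur orthogonality: average [rho x *m E_ij *m rho x^-1] over G and sum the
   (i, j) entries. *)
Lemma sum_repr_char_norm : \sum_(x in G) `|chi x| ^+ 2 = #|G|%:R.
Proof.
have nz_d : (d%:R : C) != 0 by rewrite pnatr_eq0 -lt0n mx_irr_degree_gt0.
pose f i j := \sum_(x in G) rho x *m delta_mx i j *m rho x^-1%g.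
have fE i j : f i j = (#|G|%:R * (i == j)%:R / d%:R)%:M.
  rewrite [LHS]centgmx_scalar; last first.
    apply/centgmxP => h Gh; rewrite mulmx_suml mulmx_sumr.
    rewrite (reindex_inj (mulgI h)) /=.
    apply: eq_big => [y|y]; first by rewrite groupMl.
    rewrite groupMl // => Gy; rewrite invMg !repr_mxM ?groupV //.
    by rewrite !mulmxA repr_mxKV.
  congr (_ / _)%:M; rewrite linear_sum /= mulr_natl -sumr_const.
  apply: eq_bigr => y Gy; rewrite mxtrace_mulC mulmxA -repr_mxM ?groupV //.
  rewrite mulVg repr_mx1 mul1mx /mxtrace (bigD1 i) //= mxE eqxx big1 ?addr0 //.
  by move=> k /negPf neq_ki; rewrite mxE neq_ki.
transitivity (\sum_i \sum_j f i j i j).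
  under eq_bigr => x Gx do
    rewrite normCK -repr_charV // /repr_char /mxtrace big_distrl.
  rewrite exchange_big; apply: eq_bigr => i _ /=.
  under eq_bigr => x Gx do rewrite big_distrr.
  rewrite exchange_big; apply: eq_bigr => j _ /=.
  rewrite summxE; apply: eq_bigr => x Gx; rewrite mxE (bigD1 j) //= big1 ?addr0.
    rewrite mxE (bigD1 i) //= big1 ?addr0 => [|k /negPf neq_ki].
      by rewrite mxE !eqxx mulr1.
    by rewrite mxE neq_ki mulr0.
  move=> k /negPf neq_kj; rewrite mxE big1 ?mul0r // => l _.
  by rewrite mxE neq_kj andbF mulr0.
under eq_bigr => i _.
  rewrite (bigD1 i) //= big1 ?addr0 => [|j neq_ji].
    rewrite fE mxE !eqxx mulr1 mulr1n; over.
  by rewrite fE mxE eq_sym (negPf neq_ji) mulr0n.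
by rewrite sumr_const card_ord -[LHS]mulr_natr mulfVK.
Qed.

(** The product of the central idempotent e with [a]; for unitary [rho], [chi g^-1] is the conjugate
    of [chi g]. *)
Definition char_conv a (u : gT) : C :=
  d%:R / #|G|%:R * \sum_(g in G) chi g^-1%g * a (g^-1 * u)%g.

Lemma char_conv_form N a b : (N <| G)%g ->
  herm_form (res_char N) (char_conv a) b =
  (\sum_(n in N) `|chi n| ^+ 2) / #|G|%:R * herm_form (res_char G) a b.
Proof.
move=> nsNG; rewrite /herm_form.
have nz_d : (d%:R : C) != 0 by rewrite pnatr_eq0 -lt0n mx_irr_degree_gt0.
transitivity (\sum_(g in G) \sum_(u in G) \sum_(v in G)
    d%:R / #|G|%:R * (a u * (b v)^*) *
      (chi g^-1%g * res_char N (g * (u * v^-1))%g)).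
  transitivity (\sum_(g in G) \sum_(u in G) \sum_(v in G)
      d%:R / #|G|%:R * (a (g^-1 * u)%g * (b v)^*) *
        (chi g^-1%g * res_char N (u * v^-1)%g)).
    rewrite [RHS]exchange_big; apply: eq_bigr => u _ /=.
    rewrite [RHS]exchange_big; apply: eq_bigr => v _ /=.
    rewrite /char_conv -2![LHS]mulrA big_distrl big_distrr /=.
    by apply: eq_bigr => g _; ring.
  (* The substitution of [g * u] for [u] moves [g] from [a] into [res_char N]. *)
  apply: eq_bigr => g Gg; rewrite (reindex_inj (mulgI g)) /=.
  apply: eq_big => [u|u _]; first by rewrite groupMl.
  by apply: eq_bigr => v _; rewrite mulKg mulgA.
rewrite exchange_big big_distrr; apply: eq_bigr => u Gu /=.
rewrite exchange_big big_distrr; apply: eq_bigr => v Gv /=.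
rewrite -big_distrr /= res_char_convolution ?groupM ?groupV //.
rewrite [res_char G _]ifT ?groupM ?groupV //.
by field; rewrite nz_d pnatr_eq0 -lt0n cardG_gt0.
Qed.

Lemma res_char_form_ge N a : (N <| G)%g ->
  (\sum_(n in N) `|chi n| ^+ 2) / #|G|%:R * herm_form (res_char G) a a <=
  herm_form (res_char N) a a.
Proof.
move=> nsNG; have sNG := normal_sub nsNG.
set c := _ / _; have c_real : c^* = c.
  rewrite conj_Creal // ger0_real // divr_ge0 ?ler0n ?sumr_ge0 // => n _.
  by rewrite exprn_ge0.
have formC (M : {group gT}) b b' : M \subset G ->
    (herm_form (res_char M) b b')^* = herm_form (res_char M) b' b.
  by move=> sMG; rewrite herm_form_conj //; apply: res_charV.
set Q := herm_form _ a a; have Q_real : Q^* = Q by rewrite formC.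
pose e := char_conv a.
have Qea : herm_form (res_char N) e a = c * Q by rewrite char_conv_form.
have Qae : herm_form (res_char N) a e = c * Q.
  by rewrite -formC // Qea rmorphM /= c_real Q_real.
(* Idempotency of e enters here: the second use of [char_conv_form], with [G] for [N], has constant
   1 by [sum_repr_char_norm]. *)
have Qee : herm_form (res_char N) e e = c * Q.
  rewrite char_conv_form // -formC // char_conv_form ?normal_refl //.
  by rewrite sum_repr_char_norm divff ?mul1r ?Q_real // pnatr_eq0 -lt0n cardG_gt0.
have := res_char_form_ge0 (fun x => a x - e x) sNG.
by rewrite herm_formBl !herm_formBr Qea Qae Qee subrr subr0 subr_ge0.
Qed.

End CharacterForms.

(** * Alternating words and powers of the Fourier coefficient *)

Section FourierWords.
Local Open Scope sesquilinear_scope.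
Variables (C : numClosedFieldType) (gT : finGroupType) (G : {group gT}).
Variables (d : nat) (rho : mx_representation C G d) (F : gT -> C).

Definition alt_letter i (x : gT) : C := if odd i then (F x^-1%g)^* else F x.

Hypothesis rho_unitary : unitary_repr rho.
Local Notation A := (fourier_coef rho F).

(** Cyclicity of the trace brings the matrix of the last letter to the left of [M], where summing
    over the letter gives a Fourier coefficient. *)
Lemma word_sum_trace n w (M : 'M_d) :
  word_sum G n.+1 w (fun x => \tr (M *m rho x)) =
  word_sum G n w (fun x => \tr (fourier_coef rho (w n) *m M *m rho x)).
Proof.
rewrite /= -word_sum_lin; apply: eq_word_sum => // x Gx.
rewrite -mulmxA mulmx_suml linear_sum; apply: eq_bigr => g Gg /=.
by rewrite repr_mxM // -scalemxAl linearZ /= mulmxA (mxtrace_mulC (_ *m _)).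
Qed.

Lemma fourier_coef_adj : fourier_coef rho (fun x => (F x^-1%g)^*) = A^t*.
Proof.
rewrite /fourier_coef linear_sum map_mx_sum (reindex_inj invg_inj) /=.
apply: eq_big => [g|g]; rewrite groupV // => Gg.
by rewrite invgK linearZ /= map_mxZ repr_mxV_adj.
Qed.

Lemma word_sum_alt_trace p (M : 'M_d) :
  word_sum G p.*2 alt_letter (fun x => \tr (M *m rho x)) =
  \tr ((A *m A^t*) ^+ p *m M).
Proof.
elim: p M => [|p IHp] M; first by rewrite /= repr_mx1 mulmx1 expr0 mul1mx.
rewrite doubleS !word_sum_trace.
(* The last letter has odd index and contributes the adjoint of [A]; the one before it contributes
   [A]. *)
have -> : alt_letter p.*2.+1 = fun x => (F x^-1%g)^*.
  by rewrite /alt_letter /= odd_double.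
have -> : alt_letter p.*2 = F by rewrite /alt_letter odd_double.
by rewrite fourier_coef_adj IHp exprSr -![_ * _]/(_ *m _) !mulmxA.
Qed.

End FourierWords.

(** * Both sides of the inequality as Hermitian forms *)

Theorem proposition5p1 (R : realType) (gT : finGroupType) (G N : {group gT})
    (F : gT -> R[i]) (d : nat) (rho : mx_representation R[i] G d) (q : nat) :
  (N <| G)%g ->
  mx_irreducible rho ->
  unitary_repr rho ->
  (0 < q)%N -> ~~ odd q ->
  schatten_norm q (fourier_coef rho F) ^+ q <=
    #|G|%:R / (\sum_(n in N) `|repr_char rho n| ^+ 2) *
    \sum_(g : {ffun 'I_q -> gT} |
            [forall i, g i \in G] && ((\prod_(i < q) g i)%g \in N))
      alternating_prod F g * repr_char rho (\prod_(i < q) g i)%g.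
Proof.
move=> nsNG rho_irr rho_unitary q_gt0 q_even.
set chi := repr_char rho; set S := \sum_(n in N) _.
pose p := q./2; have defq : q = p.*2 by rewrite even_halfK.
have p_gt0 : (0 < p)%N by rewrite -double_gt0 -defq.
pose k := word_coef G p (alt_letter F).
have formE psi : word_sum G q (alt_letter F) psi = herm_form G psi k k.
  rewrite defq -addnn word_sum_palindrome // => i x lt_ip.
  (* The mirrored indices [p + i] and [p - i.+1] add up to an odd number, so exactly one of the two
     letters is conjugated. *)
  rewrite /alt_letter oddD oddB // oddS.
  by case: (odd p); case: (odd i); rewrite ?invgK ?conjCK.
have schattenE :
    schatten_norm q (fourier_coef rho F) ^+ q = herm_form G (res_char rho G) k k.
  rewrite -formE defq schatten_normX // -mxtrace_expr_mulC //.
  rewrite -[X in \tr X]mulmx1 -word_sum_alt_trace //.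
  by apply: eq_word_sum => // x Gx; rewrite mul1mx /res_char Gx.
have sumE : \sum_(g : {ffun 'I_q -> gT} |
      [forall i, g i \in G] && ((\prod_(i < q) g i)%g \in N))
    alternating_prod F g * chi (\prod_(i < q) g i)%g =
    herm_form G (res_char rho N) k k.
  rewrite -formE -word_sumE big_mkcondr; apply: eq_bigr => g _.
  by rewrite /res_char; case: ifP; rewrite ?mulr0.
(* The term at the identity is the square of [d], which is positive. *)
have S_gt0 : 0 < S.
  rewrite /S (bigD1 1%g) //= ltr_pwDl ?sumr_ge0 // => [|n _]; last first.
    by rewrite exprn_ge0.
  rewrite exprn_gt0 // normr_gt0 /chi /repr_char repr_mx1 mxtrace1 pnatr_eq0.
  by rewrite -lt0n (mx_irr_degree_gt0 rho_irr).
have cG_gt0 : 0 < #|G|%:R :> R[i] by rewrite ltr0n cardG_gt0.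
rewrite schattenE sumE -ler_pdivrMl ?divr_gt0 // invf_div.
exact: res_char_form_ge.
Qed.
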